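(* Let $r\ge3$ be an odd integer and $a=r+3$. The subtraction game $\mathcal{S}(1,a,3a+r)$ is ultimately periodic with period $4a-2$ and nim-sequence $\big((01)^{a/2-1}\,2\big)^3(01)^{a/2}\,2$. Moreover, if $r=3$ then the subtraction set is non-expandable; otherwise the subtraction set has expansion $\{1,a,4a-3,4a-1,5a-2,9a-4\}$ $(=\{1,a,3a+r,3a+r+2,4a+r+1,7a+2r+2\})$.
   Context: For a finite set $S$ of positive integers, the subtraction game $\mathcal{S}(S)$ is played on a single pile: two players alternately remove $s\in S$ coins (at most the pile size); the last mover wins. The nim-value is $\mathcal{G}(n)=\operatorname{mex}\{\mathcal{G}(n-s): s\in S, s\le n\}$. Words of single digits are written by juxtaposition, and $x^m$ denotes $m$-fold repetition of the block $x$. ''The game is ultimately periodic with period $p$ and nim-sequence $W$'' ($W$ a word of length $p$) means $p$ is the least positive integer with $\mathcal{G}(n+p)=\mathcal{G}(n)$ for all sufficiently large $n$, and there is $n_0\ge0$ such that $\mathcal{G}(n_0+j)$ is the $((j\bmod p)+1)$-st letter of $W$ for all $j\ge0$. The expansion of $S$ is $S^{ex}=\{s\ge1:\mathcal{G}(n+s)\ne\mathcal{G}(n)\ \forall n\ge0\}$; ''has expansion $T$'' means $S^{ex}=T$. For a set $X$ and $p\ge1$, $X^{*p}=\{x+mp:x\in X,m\ge0\}$. $S$ is non-expandable if $S^{ex}=S$ or $S^{ex}=S^{*p}$, $p$ the period. *)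

(* Defs.v *)
From mathcomp Require Import all_boot.
From mathcomp Require Import classical_sets.

Set Implicit Arguments.
Unset Strict Implicit.
Unset Printing Implicit Defensive.

Local Open Scope classical_set_scope.

(* The search range [0, size s] suffices since s has at most size s distinct
   elements; see mexP. *)
Definition mex (s : seq nat) : nat :=
  find [pred k | k \notin s] (iota 0 (size s).+1).

(* A finite subtraction set is given by a sequence of positive integers.
   nim_prefix S n lists the nim-values of the piles of sizes 0, ..., n - 1;
   the recursive equation of the nim-values is nim_valueE. *)
Fixpoint nim_prefix (S : seq nat) (n : nat) : seq nat :=
  if n is m.+1 then
    let v := nim_prefix S m in
    rcons v (mex [seq nth 0 v (m - s) | s <- S & s <= m])
  else [::].

Definition nim_value (S : seq nat) (n : nat) : nat :=
  last 0 (nim_prefix S n.+1).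

Definition eventually_repeats (f : nat -> nat) (p : nat) : Prop :=
  exists N, forall n, N <= n -> f (n + p) = f n.

Definition has_period (f : nat -> nat) (p : nat) : Prop :=
  [/\ 0 < p, eventually_repeats f p
    & forall q, 0 < q -> eventually_repeats f q -> p <= q].

Definition ultimately_periodic_with (S : seq nat) (p : nat) (W : seq nat)
    : Prop :=
  [/\ size W = p, has_period (nim_value S) p
    & exists n0, forall j, nim_value S (n0 + j) = nth 0 W (j %% p)].

Definition wpow (x : seq nat) (m : nat) : seq nat := flatten (nseq m x).

Definition expansion (S : seq nat) : set nat :=
  [set s | 1 <= s /\ forall n, nim_value S (n + s) <> nim_value S n].

Definition star (X : set nat) (p : nat) : set nat :=
  [set y | exists x m, X x /\ y = x + m * p].

Definition non_expandable (S : seq nat) : Prop :=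
  expansion S = [set` S] \/
  exists p, has_period (nim_value S) p /\ expansion S = star [set` S] p.

Lemma mexP (s : seq nat) :
  mex s \notin s /\ forall k, k < mex s -> k \in s.
Proof.
have ex : has [pred k | k \notin s] (iota 0 (size s).+1).
  apply/negPn/negP => /hasPn sub.
  suff: size (iota 0 (size s).+1) <= size s by rewrite size_iota ltnn.
  apply: uniq_leq_size (iota_uniq _ _) _ => k /sub.
  by rewrite /= negbK.
have lt_mex : mex s < (size s).+1.
  by have := ex; rewrite has_find size_iota.
split=> [|k lt_k].
  by have := nth_find 0 ex; rewrite -/(mex s) nth_iota.
have := before_find 0 lt_k.
rewrite nth_iota; last exact: ltn_trans lt_k lt_mex.
by rewrite /= add0n => /negbFE.
Qed.

Lemma size_nim_prefix S n : size (nim_prefix S n) = n.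
Proof. by elim: n => //= n IHn; rewrite size_rcons IHn. Qed.

Lemma nth_nim_prefix S n m :
  m < n -> nth 0 (nim_prefix S n) m = nim_value S m.
Proof.
elim: n => // n IHn; rewrite ltnS leq_eqVlt => /orP[/eqP-> | lt_mn].
  by rewrite /nim_value /= last_rcons nth_rcons size_nim_prefix ltnn eqxx.
by rewrite /= nth_rcons size_nim_prefix lt_mn IHn.
Qed.

Lemma nim_valueE S n : all (leq 1) S ->
  nim_value S n = mex [seq nim_value S (n - s) | s <- S & s <= n].
Proof.
move=> /allP S_gt0; rewrite {1}/nim_value /= last_rcons; congr mex.
apply/eq_in_map => s; rewrite mem_filter => /andP[le_sn /S_gt0 s_gt0].
by rewrite nth_nim_prefix // ltn_subrL s_gt0 (leq_trans s_gt0).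
Qed.

(* Main.v *)
Require Import Defs.
From mathcomp Require Import all_boot.
From mathcomp Require Import classical_sets.
From mathcomp Require Import zify.

(* With a = 2h and p = 4a - 2 = 8h - 2 the subtraction set is {1, a, p - 1}.
   For h >= 4, cut the nim-sequence into rows of length p: the first three rows
   and the common value of all later rows have explicit block decompositions,
   which are verified against the mex rule position by position.  A residue t
   mod p at which the steady row never meets its shift by t is one of 1, -1, a,
   -a, p/2; comparing the piles 0 and 1 with the piles s, s + 1 then leaves six
   values of s.  The case h = 3 has a different preperiod, but the same steady
   row, and is settled by computation. *)

Local Open Scope classical_set_scope.

(** * Explicit rows of the nim-sequence *)

(** As a word, for h >= 3: three blocks (01)^h 2, then (01)^(h-3) 0. *)
Definition base_row (h j : nat) : nat :=
  if j < 2 * h then odd j : nat else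
  if j == 2 * h then 2 else
  if j < 4 * h + 1 then ~~ odd j : nat else
  if j == 4 * h + 1 then 2 else
  if j < 6 * h + 2 then odd j : nat else
  if j == 6 * h + 2 then 2 else ~~ odd j.

(** As a word, for h >= 3: 1012, then (01)^(h-1) 2 twice, then (01)^h 2 (01)^(h-3) 0. *)
Definition steady_row (h j : nat) : nat :=
  if j < 3 then ~~ odd j : nat else
  if j == 3 then 2 else
  if j < 2 * h + 2 then odd j : nat else
  if j == 2 * h + 2 then 2 else base_row h j.

(* Row k >= 1 holds the nim-values of the piles (k - 1) p + j; row 0 stands for
   the negative piles, with the dummy value 4, larger than any nim-value, which
   does not affect a mex. *)
Definition row (h k j : nat) : nat :=
  match k with
  | 0 => 4
  | 1 => if j == 8 * h - 3 then 2 else base_row h j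
  | 2 => if j < 4 then 2 + ~~ odd j else base_row h j
  | 3 => if j < 3 then ~~ odd j : nat else
         if j == 3 then 2 else
         if j == 2 * h + 1 then 3 else
         if j == 2 * h + 2 then 2 else base_row h j
  | _ => steady_row h j
  end.

Definition grid_value (h n : nat) : nat :=
  row h (n %/ (8 * h - 2)) (n %% (8 * h - 2)).

Ltac eval_row :=
  unfold row, steady_row, base_row;
  repeat match goal with |- context [if ?b then _ else _] =>
    first [ have -> : b = true by lia
          | have -> : b = false by lia
          | let H := fresh "H" in case H : b ] end.

(** All parities are expressed through that of [j], so a single split settles them; [bE] keeps the
    parity available to [lia]. *)
Ltac eval_odd j :=
  let b := fresh "b" in
  let bE := fresh "bE" in
  case: (ex_intro (fun b => b = odd j) _ erefl) => b bE;
  repeat match goal with |- context [odd ?x] =>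
    first [ have -> : odd x = b by lia
          | have -> : odd x = ~~ b by lia
          | have -> : odd x = true by lia
          | have -> : odd x = false by lia ] end;
  case: b bE => bE.

(** * The mex rule on the rows *)

Definition is_mex (v x y z : nat) : Prop :=
  [/\ v <> x, v <> y, v <> z &
   forall i, i < v -> i = x \/ i = y \/ i = z].

(* The last three arguments are the entries 1, a and p - 1 places earlier in the
   row-major order. *)
Lemma row_mex (h k j : nat) : 4 <= h -> j < 8 * h - 2 ->
  is_mex (row h k.+1 j)
    (if j == 0 then row h k (8 * h - 3) else row h k.+1 j.-1)
    (if 2 * h <= j then row h k.+1 (j - 2 * h) else row h k (j + 6 * h - 2))
    (if j < 8 * h - 3 then row h k j.+1 else row h k.+1 0).
Proof.
(* From k = 4 on, both rows involved are steady. *)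
move=> h4 jp; case: k => [|[|[|[|k]]]].
all: eval_row; eval_odd j; first
  [ by split=> //; case=> [|[|[|i]]] //= _;
    by [left | right; left | right; right]
  | by exfalso; lia ].
Qed.

Lemma row_le4 h k j : row h k j <= 4.
Proof. by case: k => [|[|[|[|k]]]]; eval_row; lia. Qed.

Lemma grid_value_row h k j :
  j < 8 * h - 2 -> grid_value h (k * (8 * h - 2) + j) = row h k j.
Proof.
move=> jp; have p_gt0 : 0 < 8 * h - 2 by lia.
by rewrite /grid_value divnMDl // divn_small // addn0 modnMDl modn_small.
Qed.

Lemma mex_unique (s : seq nat) v :
  v \notin s -> (forall i, i < v -> i \in s) -> mex s = v.
Proof.
have [mex_out mex_in] := mexP s => v_out v_in.
case: (ltngtP (mex s) v) => // [/v_in | /mex_in] s_in.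
  by rewrite s_in in mex_out.
by rewrite s_in in v_out.
Qed.

(** An illegal move carries the dummy 4; as v <= 4, no i < v equals it, so only legal moves can
    witness the values below v. *)
Lemma nim_value_mex a b n v (opt : nat -> nat) :
  0 < a -> 0 < b -> v <= 4 ->
  (forall s, s \in [:: 1; a; b] ->
     opt s = if s <= n then nim_value [:: 1; a; b] (n - s) else 4) ->
  is_mex v (opt 1) (opt a) (opt b) -> nim_value [:: 1; a; b] n = v.
Proof.
set S := [:: 1; a; b] => a_gt0 b_gt0 v_le4 optE [v1 va vb v_min].
rewrite nim_valueE; last by rewrite /= a_gt0 b_gt0.
apply: mex_unique => [|i lt_iv].
  apply/negP => /mapP[s]; rewrite mem_filter => /andP[le_sn s_in] vE.
  have := optE s s_in; rewrite le_sn -vE => opt_s.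
  by move: s_in; rewrite !inE => /or3P[] /eqP sE; subst s; congruence.
have opt_in s : s \in S -> i = opt s ->
    i \in [seq nim_value S (n - t) | t <- S & t <= n].
  move=> s_in; rewrite optE //; case: ifP => [le_sn iE | _]; last by lia.
  by rewrite iE; apply: map_f; rewrite mem_filter le_sn.
by case: (v_min i lt_iv) => [|[]]; apply: opt_in; rewrite !inE eqxx ?orbT.
Qed.

Lemma div_period h n : 3 <= h ->
  exists k j, j < 8 * h - 2 /\ n = k * (8 * h - 2) + j.
Proof.
move=> h3; exists (n %/ (8 * h - 2)), (n %% (8 * h - 2)).
by rewrite -divn_eq ltn_pmod //; lia.
Qed.

(** The shift by p makes room for row 0: every move s is at most p, so n + p - s is never truncated,
    and it falls in row 0 exactly when s > n. *)
Lemma nim_value_grid h n : 4 <= h ->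
  nim_value [:: 1; 2 * h; 8 * h - 3] n = grid_value h (n + (8 * h - 2)).
Proof.
move=> h4; set p := 8 * h - 2; have p_gt0 : 0 < p by lia.
elim/ltn_ind: n => n IHn.
have [k [j [jp nE]]] := div_period h n (ltnW h4).
have -> : n + p = k.+1 * p + j by rewrite nE mulSn; lia.
rewrite grid_value_row //.
apply: (@nim_value_mex _ _ _ _ (fun s => grid_value h (n + p - s)));
  rewrite ?row_le4 //; try by lia.
  move=> s s_in.
  have [s_gt0 s_lep] : 0 < s /\ s <= p.
    by move: s_in; rewrite !inE => /or3P[] /eqP ->; rewrite /p; lia.
  case: leqP => [le_sn | lt_ns].
    by rewrite IHn; [congr grid_value; lia | lia].
  by rewrite -[n + p - s](add0n _) -(mul0n p) grid_value_row //; lia.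
have mex_opt := row_mex h k j h4 jp.
have -> : grid_value h (n + p - 1) =
    if j == 0 then row h k (8 * h - 3) else row h k.+1 j.-1.
  by case: eqP => [j0 | jn0]; rewrite -grid_value_row -/p;
    try (congr grid_value; lia); lia.
have -> : grid_value h (n + p - 2 * h) =
    if 2 * h <= j then row h k.+1 (j - 2 * h) else row h k (j + 6 * h - 2).
  by case: leqP => ?; rewrite -grid_value_row -/p;
    try (congr grid_value; lia); lia.
have -> : grid_value h (n + p - (8 * h - 3)) =
    if j < 8 * h - 3 then row h k j.+1 else row h k.+1 0.
  by case: ltnP => ?; rewrite -grid_value_row -/p;
    try (congr grid_value; lia); lia.
exact: mex_opt.
Qed.

(** * The expansion for h >= 4 *)

(** The pile n is an option of n + s, and a mex differs from the value of every option. *)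
Lemma mem_expansion (S : seq nat) s :
  all (leq 1) S -> s \in S -> expansion S s.
Proof.
move=> S_gt0 s_in; split=> [|n eq_n]; first exact: (allP S_gt0).
have [+ _] := mexP [seq nim_value S (n + s - t) | t <- S & t <= n + s].
rewrite -nim_valueE // eq_n => /negP; apply.
apply/mapP; exists s; last by rewrite addnK.
by rewrite mem_filter s_in leq_addl.
Qed.

(** This and the next two lemmas put p + 1, p + a and 2p + a into the expansion; the conditional
    handles the carry into the next row. *)
Lemma row_neq_period_add1 h k j : 4 <= h -> j < 8 * h - 2 ->
  row h k.+1 j <> if j < 8 * h - 3 then row h k.+2 j.+1 else row h k.+3 0.
Proof. by move=> h4 jp; case: k => [|[|[|k]]]; eval_row; lia. Qed.

Lemma row_neq_period_add2h h k j : 4 <= h -> j < 8 * h - 2 ->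
  row h k.+1 j <> if j < 6 * h - 2 then row h k.+2 (j + 2 * h)
                  else row h k.+3 (j - (6 * h - 2)).
Proof. by move=> h4 jp; case: k => [|[|[|k]]]; eval_row; lia. Qed.

Lemma row_neq_2period_add2h h k j : 4 <= h -> j < 8 * h - 2 ->
  row h k.+1 j <> if j < 6 * h - 2 then row h k.+3 (j + 2 * h)
                  else row h k.+4 (j - (6 * h - 2)).
Proof. by move=> h4 jp; case: k => [|[|[|k]]]; eval_row; lia. Qed.

(* The five residues are 1, -1, a, -a and p/2 modulo p, where a = 2h. *)
Lemma steady_row_residues h t : 4 <= h -> t < 8 * h - 2 ->
  (forall j, j < 8 * h - 2 -> steady_row h j <>
     if j + t < 8 * h - 2 then steady_row h (j + t)
     else steady_row h (j + t - (8 * h - 2))) ->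
  t \in [:: 1; 8 * h - 3; 2 * h; 6 * h - 2; 4 * h - 1].
Proof.
move=> h4 tp diff.
(* Positions 4h + 2 and 6h hold 0 and position 0 holds 1; these three tests exclude every other
   residue. *)
have := diff (4 * h + 2) ltac:(lia).
have := diff (6 * h) ltac:(lia).
have := diff 0 ltac:(lia).
clear diff; rewrite !inE.
eval_row; eval_odd t => //= _ _ _; lia.
Qed.

(** Cyclically, consecutive 2s are 2h - 1 apart, except for one gap of 2h + 1, between 4h + 1 and 6h
    + 2; a rotation preserving the row must fix that gap. *)
Lemma steady_row_aperiodic h q : 3 <= h -> 0 < q -> q < 8 * h - 2 ->
  ~ (forall j, j < 8 * h - 2 -> steady_row h j =
    if j + q < 8 * h - 2 then steady_row h (j + q)
    else steady_row h (j + q - (8 * h - 2))).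
Proof.
move=> h3 q0 qp same.
have := same (4 * h + 1) ltac:(lia).
have := same (6 * h + 2) ltac:(lia).
clear same.
by eval_row; eval_odd q => //=; lia.
Qed.

Lemma nim_value_row h k j : 4 <= h -> j < 8 * h - 2 ->
  nim_value [:: 1; 2 * h; 8 * h - 3] (k * (8 * h - 2) + j) = row h k.+1 j.
Proof.
move=> h4 jp; rewrite nim_value_grid // -grid_value_row //; congr grid_value.
by rewrite mulSn; lia.
Qed.

Lemma expansion_row h : 4 <= h ->
  expansion [:: 1; 2 * h; 8 * h - 3] =
  [set` [:: 1; 2 * h; 8 * h - 3; 8 * h - 1; 10 * h - 2; 18 * h - 4]].
Proof.
move=> h4; set S := [:: 1; 2 * h; 8 * h - 3]; set p := 8 * h - 2.
have p_gt0 : 0 < p by lia.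
have S_gt0 : all (leq 1) S by rewrite /=; lia.
have nimE k j n : j < p -> n = k * p + j -> nim_value S n = row h k.+1 j.
  by move=> jp ->; apply: nim_value_row.
have nim_shift k j t : j < p -> t < p -> nim_value S (k * p + j + t) =
    if j + t < p then row h k.+1 (j + t) else row h k.+2 (j + t - p).
  by move=> jp tp; case: ltnP => ?; apply: nimE; rewrite ?mulSn; lia.
apply/seteqP; split=> s /=; last first.
  rewrite !inE => /or4P[/eqP->|/eqP->|/eqP->|].
  - by apply: mem_expansion => //; rewrite !inE eqxx.
  - by apply: mem_expansion => //; rewrite !inE eqxx ?orbT.
  - by apply: mem_expansion => //; rewrite !inE eqxx ?orbT.
  move=> s_in; split=> [|n]; first by lia.
  have [k [j [jp nE]]] := div_period h n (ltnW h4).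
  rewrite (nimE k j n) //.
  case/or3P: s_in => /eqP ->; apply/nesym.
  - have -> : n + (8 * h - 1) = k.+1 * p + j + 1 by rewrite nE mulSn; lia.
    have := row_neq_period_add1 h k j h4 jp.
    rewrite nim_shift //; last by lia.
    have -> : (j + 1 < p) = (j < 8 * h - 3) by lia.
    case: ltnP => ?; first by rewrite addn1.
    by have -> : j + 1 - p = 0 by lia.
  - have -> : n + (10 * h - 2) = k.+1 * p + j + 2 * h by rewrite nE mulSn; lia.
    have := row_neq_period_add2h h k j h4 jp.
    rewrite nim_shift //; last by lia.
    have -> : (j + 2 * h < p) = (j < 6 * h - 2) by lia.
    case: ltnP => ? //.
    by have -> : j + 2 * h - p = j - (6 * h - 2) by lia.
  - have -> : n + (18 * h - 4) = k.+2 * p + j + 2 * h by rewrite nE !mulSn; lia.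
    have := row_neq_2period_add2h h k j h4 jp.
    rewrite nim_shift //; last by lia.
    have -> : (j + 2 * h < p) = (j < 6 * h - 2) by lia.
    case: ltnP => ? //.
    by have -> : j + 2 * h - p = j - (6 * h - 2) by lia.
case=> s_gt0 s_exp; have [q [t [tp sE]]] := div_period h s (ltnW h4).
(* Piles from 3p on lie in steady rows, which restricts the residue t of s. *)
have /steady_row_residues : forall j, j < p -> steady_row h j <>
     if j + t < p then steady_row h (j + t) else steady_row h (j + t - p).
  move=> j jp; have := s_exp (3 * p + j).
  have -> : 3 * p + j + s = (3 + q) * p + j + t by rewrite sE mulnDl; lia.
  by rewrite nim_shift // (nimE 3 j) // => /nesym; apply.
move=> /(_ h4 tp); rewrite !inE.
(* Piles 0 and 1 have values 0 and 1; when t = p - 1, pile s + 1 opens a new row. *)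
have val0 : row h q.+1 t <> 0.
  have := s_exp 0; rewrite add0n (nimE q t s) // (nimE 0 0 0) //.
  by eval_row.
have val1 : t = 8 * h - 3 -> row h q.+2 0 <> 1.
  move=> tE; have := s_exp 1.
  rewrite (nimE q.+1 0 (1 + s)) //; last by rewrite sE mulSn; lia.
  by rewrite (nimE 0 1 1) //; [eval_row | lia].
clear s_exp.
(* What survives: q = 0, 1 for t = 1; q = 0 for t = p - 1; q = 0, 1, 2 for t = a; nothing for t = p
   - a or p/2, where the value is always 0. *)
case/or4P => [/eqP tE|/eqP tE|/eqP tE|].
- case: q val0 {val1} sE => [|[|q]] val0 sE; try lia.
  by case: val0; rewrite tE; case: q {sE}.
- case: q val1 {val0} sE => [|q] val1 sE; first by lia.
  by case: (val1 tE); case: q {val1 sE}.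
- case: q val0 {val1} sE => [|[|[|q]]] val0 sE; try lia.
  by case: val0; rewrite tE; eval_row; lia.
by case/orP => /eqP tE; case: val0; rewrite tE; case: (q) => [|[|[|?]]];
  eval_row; lia.
Qed.

(** * Least period and nim-sequence *)

Definition period_word (h : nat) : seq nat :=
  let B := wpow [:: 0; 1] (h - 1) ++ [:: 2] in
  wpow B 3 ++ wpow [:: 0; 1] h ++ [:: 2].

Lemma size_wpow01 m : size (wpow [:: 0; 1] m) = 2 * m.
Proof. by elim: m => //= m IHm; rewrite -/(wpow _ _) IHm; lia. Qed.

Lemma nth_wpow01 m i : i < 2 * m -> nth 0 (wpow [:: 0; 1] m) i = odd i.
Proof.
elim: m i => // m IHm [|[|i]] //= lt_im; rewrite negbK; apply: IHm; lia.
Qed.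

Lemma size_period_word h : 0 < h -> size (period_word h) = 8 * h - 2.
Proof.
move=> h0; rewrite /period_word /wpow /= !size_cat /= -!/(wpow _ _).
by rewrite !size_wpow01; lia.
Qed.

(** The word is the steady row rotated to start just after its last 2, at 6h + 3, which is 2h - 5
    places before the end of the row. *)
Lemma nth_period_word h i : 3 <= h -> i < 8 * h - 2 ->
  nth 0 (period_word h) i =
  if i < 2 * h - 5 then steady_row h (6 * h + 3 + i)
  else steady_row h (i - (2 * h - 5)).
Proof.
move=> h3 lt_i.
have -> : nth 0 (period_word h) i =
    if i < 2 * h - 2 then odd i : nat else if i == 2 * h - 2 then 2 else
    if i < 4 * h - 3 then ~~ odd i : nat else if i == 4 * h - 3 then 2 else
    if i < 6 * h - 4 then odd i : nat else if i == 6 * h - 4 then 2 else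
    if i < 8 * h - 3 then ~~ odd i : nat else 2.
  rewrite /period_word /wpow /= !catA cats0 -!/(wpow _ _).
  rewrite !(nth_cat, size_cat, size_wpow01) /=.
  eval_row; rewrite ?nth_wpow01; try lia; eval_odd i => //=;
    match goal with |- context [nth 0 [:: 2] ?x] =>
      by have -> : x = 0 by lia end.
by eval_row; eval_odd i; lia.
Qed.

(** All that the period argument needs, shared by the cases h >= 4 and h = 3; [n0] is 3p in both. *)
Definition steady (h n0 : nat) (S : seq nat) : Prop :=
  forall m j, j < 8 * h - 2 ->
    nim_value S (n0 + m * (8 * h - 2) + j) = steady_row h j.

Lemma steady_shift h n0 S m j t :
  steady h n0 S -> j < 8 * h - 2 -> t < 8 * h - 2 ->
  nim_value S (n0 + m * (8 * h - 2) + j + t) =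
  if j + t < 8 * h - 2 then steady_row h (j + t)
  else steady_row h (j + t - (8 * h - 2)).
Proof.
move=> steady_S jp tp; case: ltnP => ?; first by rewrite -addnA steady_S.
by rewrite -(steady_S m.+1); [congr nim_value; rewrite mulSn; lia | lia].
Qed.

Lemma steady_has_period h n0 S :
  3 <= h -> steady h n0 S -> has_period (nim_value S) (8 * h - 2).
Proof.
move=> h3 steady_S; set p := 8 * h - 2; have p_gt0 : 0 < p by lia.
split=> // [|q q_gt0 [N q_period]].
  exists n0 => n n0n; have [k [j [jp kE]]] := div_period h (n - n0) h3.
  have -> : n = n0 + k * p + j by lia.
  rewrite steady_S // -(steady_S k.+1) //.
  by congr nim_value; rewrite mulSn; lia.
rewrite leqNgt; apply/negP => qp.
apply: (steady_row_aperiodic h q h3 q_gt0 qp) => j jp.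
(* The N-th row after [n0] starts at or beyond N, where q is a period. *)
rewrite -(steady_shift _ n0 S N) // q_period ?steady_S //.
by rewrite addnAC; apply: leq_trans (leq_pmulr N p_gt0) (leq_addl _ _).
Qed.

Lemma steady_ultimately_periodic h n0 S : 3 <= h -> steady h n0 S ->
  ultimately_periodic_with S (8 * h - 2) (period_word h).
Proof.
move=> h3 steady_S; set p := 8 * h - 2.
split; [by rewrite size_period_word; lia | exact: steady_has_period steady_S |].
exists (n0 + (6 * h + 3)) => i; have [k [j [jp ->]]] := div_period h i h3.
rewrite modnMDl modn_small // nth_period_word //.
have -> : n0 + (6 * h + 3) + (k * p + j) = n0 + k * p + (6 * h + 3) + j by lia.
have -> : (j < 2 * h - 5) = (6 * h + 3 + j < p) by lia.
rewrite steady_shift //; last by lia.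
by have -> : j - (2 * h - 5) = 6 * h + 3 + j - p by lia.
Qed.

(** * The case h = 3: the set {1, 6, 21} *)

(** A preperiod of 52 values and five periods of 22, enough for all finite checks below. *)
Definition nim_6_21 (n : nat) : nat :=
  nth 0
    ([:: 0; 1; 0; 1; 0; 1; 2; 0; 1; 0; 1; 0; 1; 2; 0; 1; 0; 1; 0; 1; 2; 3;
      2; 3; 2; 3; 0; 1; 3; 0; 1; 0; 1; 0; 1; 2; 0; 1; 0; 1; 0; 1; 2; 0;
      1; 0; 1; 2; 0; 1; 2; 3]
     ++ flatten (nseq 5
     [:: 2; 0; 1; 0; 1; 2; 0; 1; 0; 1; 0; 1; 2; 0; 1; 0; 1; 2; 0; 1; 0; 1])) n.

Lemma nim_value_6_21_lt n : n < 162 -> nim_value [:: 1; 6; 21] n = nim_6_21 n.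
Proof.
by move=> n_lt; rewrite -(nth_nim_prefix _ n_lt) /nim_6_21; congr nth.
Qed.

(** A nim-value depends only on the 21 preceding ones, so agreement on the window from 52 to 72
    propagates by induction. *)
Lemma nim_value_6_21_periodic n : 52 <= n ->
  nim_value [:: 1; 6; 21] (n + 22) = nim_value [:: 1; 6; 21] n.
Proof.
elim/ltn_ind: n => n IHn n_ge.
case: (ltnP n 73) => [n_lt | n_ge73].
  rewrite !nim_value_6_21_lt; try lia.
  have check : all (fun n => nim_6_21 (n + 22) == nim_6_21 n) (iota 52 21)
    by vm_compute.
  by apply/eqP/(allP check); rewrite mem_iota; lia.
rewrite !nim_valueE //; congr mex.
have -> : [seq s <- [:: 1; 6; 21] | s <= n + 22] = [:: 1; 6; 21].
  by apply/all_filterP; rewrite /=; lia.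
have -> : [seq s <- [:: 1; 6; 21] | s <= n] = [:: 1; 6; 21].
  by apply/all_filterP; rewrite /=; lia.
by congr [:: _; _; _]; rewrite -addnBAC ?IHn //; lia.
Qed.

Lemma nim_value_6_21_steady : steady 3 66 [:: 1; 6; 21].
Proof.
move=> m j j_lt; elim: m => [|m IHm].
  rewrite mul0n addn0 nim_value_6_21_lt; last by lia.
  have check : all (fun j => nim_6_21 (66 + j) == steady_row 3 j) (iota 0 22)
    by vm_compute.
  by apply/eqP/(allP check); rewrite mem_iota; lia.
rewrite -IHm -[RHS]nim_value_6_21_periodic; last by lia.
by congr nim_value; rewrite mulSn; lia.
Qed.

(** For s < 74 outside the set, the table contains a collision. If s >= 74 = 52 + 22, then n + s -
    22 is past the preperiod, so a collision for s - 22 is one for s. *)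
Lemma expansion_6_21 : expansion [:: 1; 6; 21] = [set` [:: 1; 6; 21]].
Proof.
set S := [:: 1; 6; 21]; apply/seteqP; split=> s /=; last exact: mem_expansion.
case=> s_gt0 s_exp.
have small t : 0 < t -> t < 74 -> t \notin S ->
    exists n, nim_value S (n + t) = nim_value S n.
  move=> t_gt0 t_lt t_out.
  have check : all (fun t => (t \in S) ||
      has (fun n => nim_6_21 (n + t) == nim_6_21 n) (iota 0 70)) (iota 1 73)
    by vm_compute.
  have t_in : t \in iota 1 73 by rewrite mem_iota; lia.
  case/orP: (allP check t t_in) => [|/hasP[n]]; first by rewrite (negPf t_out).
  rewrite mem_iota => n_lt /eqP eq_n; exists n.
  by rewrite !nim_value_6_21_lt //; lia.
apply/negPn/negP => s_out.
suff [n /s_exp //] : exists n, nim_value S (n + s) = nim_value S n.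
clear s_exp; elim/ltn_ind: s s_gt0 s_out => s IHs s_gt0 s_out.
case: (ltnP s 74) => [|s_ge]; first by move=> ?; apply: small.
have [||n nE] := IHs (s - 22) ltac:(lia); first by lia.
  by rewrite !inE; lia.
exists n; rewrite -nE -[RHS]nim_value_6_21_periodic; last by lia.
by congr nim_value; lia.
Qed.

Theorem theorem3p17 (r a : nat) :
  3 <= r -> odd r -> a = r + 3 ->
  let S := [:: 1; a; 3 * a + r] in
  let B := wpow [:: 0; 1] (a %/ 2 - 1) ++ [:: 2] in
  let W := wpow B 3 ++ wpow [:: 0; 1] (a %/ 2) ++ [:: 2] in
  let T := [:: 1; a; 4 * a - 3; 4 * a - 1; 5 * a - 2; 9 * a - 4] in
  let T' := [:: 1; a; 3 * a + r; 3 * a + r + 2; 4 * a + r + 1;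
                7 * a + 2 * r + 2] in
  [/\ ultimately_periodic_with S (4 * a - 2) W,
      r = 3 -> non_expandable S
    & r <> 3 -> expansion S = [set` T] /\ [set` T] = [set` T']].
Proof.
move=> r3 r_odd aE S B W T T'.
(* Since r is odd, a is even; and r = a - 3 gives 3a + r = 4a - 3 = 8h - 3. The case r = 3 is h =
   3. *)
have [h [h3 aE2]] : exists h, 3 <= h /\ a = 2 * h by exists (a %/ 2); lia.
have WE : W = period_word h.
  by rewrite /W /B /period_word; have -> : a %/ 2 = h by lia.
have SE : S = [:: 1; 2 * h; 8 * h - 3].
  by rewrite /S aE2; congr [:: _; _; _]; lia.
have -> : 4 * a - 2 = 8 * h - 2 by lia.
rewrite WE SE; case: (ltnP 3 h) => [h4 | h_le3].
  split=> [|r_eq|_]; first 2 last.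
  - have TE' : T' = T by rewrite /T /T'; congr [:: _; _; _; _; _; _]; lia.
    rewrite TE' expansion_row //; split=> //.
    have -> // : T = [:: 1; 2 * h; 8 * h - 3; 8 * h - 1; 10 * h - 2; 18 * h - 4].
    by rewrite /T aE2; congr [:: _; _; _; _; _; _]; lia.
  - apply: (steady_ultimately_periodic h (3 * (8 * h - 2))) => // m j jp.
    by rewrite -mulnDl nim_value_row.
  - by lia.
have -> : h = 3 by lia.
split=> [|_|r_neq]; last by lia.
  exact: (steady_ultimately_periodic 3 66 _ _ nim_value_6_21_steady).
by left; exact: expansion_6_21.
Qed.
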